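(* Let $A$ be a Banach algebra, and let $a,b,c,d\in A$ satisfy $(ac)^2a=(db)^2a$ and $(ac)^2d=(db)^2d$. Then the following are equivalent: (1) $ac$ has generalized Hirano inverse. (2) $bd$ has generalized Hirano inverse.
   Context: All Banach algebras are complex with identity $1$. For $a\in A$, $comm(a)=\{x\in A : xa=ax\}$, and $A^{qnil}=\{a\in A : 1+ax \text{ is invertible in } A \text{ for all } x\in comm(a)\}$ is the set of quasinilpotent elements. An element $a\in A$ has generalized Hirano inverse if there exists $b\in comm(a)$ with $b=bab$ and $a^2-ab\in A^{qnil}$. *)

(* Defs.v *)
From HB Require Import structures.
From mathcomp Require Import all_boot all_order all_algebra.
From mathcomp Require Import all_classical all_reals.
From mathcomp Require Import topology normedtype.
From mathcomp Require Export complex.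
Set Implicit Arguments.
Unset Strict Implicit.
Unset Printing Implicit Defensive.
Import Order.TTheory GRing.Theory Num.Theory.

Local Open Scope classical_set_scope.
Local Open Scope ring_scope.

(* Unital Banach algebras over K, in general noncommutative.  As for every
   normedModType, the norm takes its values in the nonnegative part of K.  The
   unit is nonzero (as in algType) but is not required to have norm 1.

   Hierarchy-Builder refuses a direct join of CompleteNormedModule and
   GRing.Algebra: Num.NumDomain already inherits from GRing.PzSemiRing and
   Num.SemiNormedZmodule, for which there is no intermediate structure.
   Hence the multiplication is introduced as a mixin on complete normed
   modules, and the resulting algType lives on the alias balg A of A. *)
HB.mixin Record CompleteNormedModule_isBanachAlgebra
    (K : numFieldType) A & CompleteNormedModule K A := {
  bone : A;
  bmul : A -> A -> A;
  bmulA : associative bmul;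
  bmul1x : left_id bone bmul;
  bmulx1 : right_id bone bmul;
  bmulDl : left_distributive bmul +%R;
  bmulDr : right_distributive bmul +%R;
  bone_neq0 : bone != 0;
  bscaleAl : forall (k : K) (x y : A), k *: bmul x y = bmul (k *: x) y;
  bscaleAr : forall (k : K) (x y : A), k *: bmul x y = bmul x (k *: y);
  bnormM_le : forall x y : A, `|bmul x y| <= `|x| * `|y|
}.

#[short(type="banachAlgType")]
HB.structure Definition BanachAlgebra (K : numFieldType) :=
  {A of CompleteNormedModule K A & CompleteNormedModule_isBanachAlgebra K A}.

Definition balg (K : numFieldType) (A : banachAlgType K) : Type := A.

Section BanachAlgebraAlgType.
Variables (K : numFieldType) (A : banachAlgType K).

HB.instance Definition _ := GRing.Lmodule.copy (balg A) A.
HB.instance Definition _ := GRing.Zmodule_isNzRing.Build (balg A)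
  (@bmulA K A) (@bmul1x K A) (@bmulx1 K A) (@bmulDl K A) (@bmulDr K A)
  (@bone_neq0 K A).
HB.instance Definition _ :=
  GRing.Lmodule_isLalgebra.Build K (balg A) (@bscaleAl K A).
HB.instance Definition _ :=
  GRing.Lalgebra_isAlgebra.Build K (balg A) (@bscaleAr K A).

End BanachAlgebraAlgType.

Section GeneralizedHirano.
Variable A : nzRingType.
Implicit Types a b x : A.

(* GRing.unit is not available: A carries no unitRingType structure. *)
Definition invertible a : Prop := exists y : A, a * y = 1 /\ y * a = 1.

Definition commutant a : set A := [set x | GRing.comm x a].

Definition qnil : set A :=
  [set a | forall x, commutant a x -> invertible (1 + a * x)].

Definition has_generalized_Hirano_inverse a : Prop :=
  exists b, [/\ commutant a b, b = b * a * b & qnil (a ^+ 2 - a * b)].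

End GeneralizedHirano.

(* Main.v *)
(* The set of quasinilpotents is governed by the spectral radius: [w] is
   quasinilpotent iff [nrm (w ^+ n) * t ^+ n] is bounded for every [t > 0]
   ([radius0]).  The nontrivial direction is Rickart's elementary argument: the
   resolvent is bounded on every disc, hence uniformly continuous there; since
   [(1 - l^2 w^2)^-1] is the mean of [(1 - l w)^-1] and [(1 + l w)^-1], the same
   modulus of continuity serves all the powers [w ^+ (2 ^ m)], and smallness of
   [(t w) ^+ (2 ^ m)] propagates in finitely many steps from small [t] to any [t].

   With [p = a c], [q = d b] and [n = p^2 - q^2] the hypotheses give
   [n p = n q = 0].  If [h] is a generalized Hirano inverse of [p], then
   [f = h^2 q^2] is the spectral idempotent of [q^2], and [q^2 - f] is
   [p^2 - p h] up to the square-zero perturbation [(1 - h^2) n], hence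
   quasinilpotent.  An element commuting with [q^2] commutes with its spectral
   data, so [h^4 q^3] is a generalized Hirano inverse of [q].  Finally Cline's
   formula [b h^2 d] passes from [d b] to [b d]. *)
Require Import Defs.
From mathcomp Require Import all_boot all_order all_algebra.
From mathcomp Require Import all_classical all_reals.
From mathcomp Require Import topology normedtype.
From mathcomp Require Import sequences.
From mathcomp Require Import ring lra.
Set Implicit Arguments.
Unset Strict Implicit.
Unset Printing Implicit Defensive.
Import Order.TTheory GRing.Theory Num.Theory.
Import numFieldNormedType.Exports.
Local Open Scope classical_set_scope.
Local Open Scope ring_scope.

(** * Real-valued norms and the Neumann series *)

Section RealNorm.
Variables (R : realType) (A : banachAlgType R[i]).
Implicit Types (x y z : balg A) (k : R[i]).

(** Norms take values in [R[i]]; [cabs] and [nrm] move them to [R], where the order is total and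
    linear arithmetic applies. *)
Definition cabs k : R := complex.Re `|k|.

Lemma cabsE k : `|k| = (cabs k)%:C%C.
Proof. by rewrite RRe_real // normr_real. Qed.

Lemma cabs_realE (t : R) : cabs t%:C%C = `|t|.
Proof. by rewrite /cabs normc_def /= expr0n addr0 sqrtr_sqr. Qed.

Lemma cabs_real (t : R) : 0 <= t -> cabs t%:C%C = t.
Proof. by move=> t0; rewrite cabs_realE ger0_norm. Qed.

Lemma gtr0c (t : R) : (0 < t%:C%C) = (0 < t).
Proof. by rewrite -ltcR. Qed.

Lemma cabsM k l : cabs (k * l) = cabs k * cabs l.
Proof. by apply/complexI; rewrite rmorphM -!cabsE normrM. Qed.

Definition nrm x : R := complex.Re `|x : A|.

Lemma nrmE x : `|x : A| = (nrm x)%:C%C.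
Proof. by rewrite RRe_real // normr_real. Qed.

Lemma nrm_ge0 x : 0 <= nrm x.
Proof. by rewrite -ler0c -nrmE normr_ge0. Qed.

Lemma nrm0 : nrm 0 = 0.
Proof. by rewrite /nrm normr0. Qed.

Lemma nrm_eq0 x : nrm x = 0 -> x = 0.
Proof. by move=> x0; apply/(@normr0_eq0 _ A); rewrite nrmE x0. Qed.

Lemma nrmN x : nrm (- x) = nrm x.
Proof. by apply/complexI; rewrite -!nrmE; exact: (@normrN _ A). Qed.

Lemma nrmD x y : nrm (x + y) <= nrm x + nrm y.
Proof. by rewrite -lecR rmorphD /= -!nrmE; exact: (@ler_normD _ A). Qed.

Lemma nrmB x y : nrm (x - y) <= nrm x + nrm y.
Proof. by rewrite -(nrmN y); exact: nrmD. Qed.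

Lemma nrmM x y : nrm (x * y) <= nrm x * nrm y.
Proof. by rewrite -lecR rmorphM /= -!nrmE; exact: bnormM_le. Qed.

Lemma nrmZ k x : nrm (k *: x) = cabs k * nrm x.
Proof.
by apply/complexI; rewrite rmorphM /= -cabsE -!nrmE; exact: (@normrZ _ A).
Qed.

(** The factor [nrm 1] covers [n = 0], since the unit need not have norm 1. *)
Lemma nrmX x n : nrm (x ^+ n) <= nrm 1 * nrm x ^+ n.
Proof.
elim: n => [|n IH]; first by rewrite !expr0 mulr1.
by rewrite !exprSr mulrA (le_trans (nrmM _ _)) // ler_wpM2r ?nrm_ge0.
Qed.

Lemma nrm_sum (I : Type) (s : seq I) (P : pred I) (F : I -> balg A) :
  nrm (\sum_(i <- s | P i) F i) <= \sum_(i <- s | P i) nrm (F i).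
Proof.
elim/big_ind2: _ => //; first by rewrite nrm0.
by move=> x u y v xu yv; rewrite (le_trans (nrmD _ _)) ?lerD.
Qed.

Lemma nrm_small x : (forall e : R, 0 < e -> nrm x <= e) -> x = 0.
Proof.
move=> h; apply/nrm_eq0/eqP; rewrite eq_le nrm_ge0 andbT.
by apply/ler_addgt0Pl => e e0; rewrite addr0 h.
Qed.

(** Neumann series: domination by a geometric series makes the partial sums Cauchy, and completeness
    supplies the inverse. *)
Lemma invertible_1sub x : nrm x < 1 -> invertible (1 - x).
Proof.
move=> x1.
have nx : `|nrm x| < 1 by rewrite ger0_norm ?nrm_ge0.
pose u (k : nat) : A := x ^+ k.
have cu : cvgn (series u).
  apply/cauchy_cvgP/cauchy_seriesP => e e0.
  have eR : e = (complex.Re e)%:C%C by rewrite RRe_real // gtr0_real.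
  have : cvgn (series (geometric (nrm (1 : balg A)) (nrm x))).
    exact: is_cvg_geometric_series.
  move/cauchy_cvgP/cauchy_seriesP/(_ (complex.Re e)).
  rewrite -gtr0c -eR => /(_ e0).
  apply: filterS => -[m n] /= h.
  rewrite [X in X < _](nrmE (\sum_(m <= k < n) x ^+ k)) eR ltcR.
  apply: le_lt_trans h; rewrite ger0_norm.
    by apply: le_trans (nrm_sum _ _ _) _; apply: ler_sum => i _; exact: nrmX.
  by apply: sumr_ge0 => i _; rewrite /geometric /= mulr_ge0 ?nrm_ge0 // exprn_ge0 // nrm_ge0.
pose y : balg A := limn (series u).
(* One index must make both the tail of the series and the remainder [x ^+ n] of the telescoping
   product small. *)
have key (e : R) : 0 < e -> exists2 n,
    nrm (y - \sum_(0 <= k < n) x ^+ k) < e & nrm (x ^+ n) < e.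
  move=> e0.
  have /cvgrPdist_lt /(_ e%:C%C) : series u @ \oo --> (y : A) by exact: cu.
  rewrite gtr0c => /(_ e0) h1.
  have /cvgrPdist_lt /(_ e e0) h2 := @cvg_geometric R (nrm (1 : balg A)) _ nx.
  have [n _ /(_ n (leqnn n)) []] := filterI h1 h2 => /=.
  rewrite /= sub0r normrN [X in X < _](nrmE (y - \sum_(0 <= k < n) x ^+ k)) ltcR => a b.
  exists n => //; apply: le_lt_trans b; rewrite ger0_norm; first exact: nrmX.
  by rewrite /geometric /= mulr_ge0 ?nrm_ge0 // exprn_ge0 // nrm_ge0.
have tel n : (1 - x) * (\sum_(0 <= k < n) x ^+ k) = 1 - x ^+ n.
  by rewrite -opprB mulNr big_mkord -subrX1 opprB.
have comm_tel n : (\sum_(0 <= k < n) x ^+ k) * (1 - x) = 1 - x ^+ n.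
  rewrite -tel; apply/esym/commr_sum => k _.
  by apply: commrX; apply/commr_sym/commrB; [exact: commr1|exact: commr_refl].
have c0 : 0 < nrm (1 - x) + 1 by rewrite ltr_wpDl ?nrm_ge0.
exists y; split; apply/eqP; rewrite -subr_eq0; apply/eqP/nrm_small => e e0.
  have [n h1 h2] := key _ (divr_gt0 e0 c0).
  have -> : (1 - x) * y - 1 = (1 - x) * (y - \sum_(0 <= k < n) x ^+ k) - x ^+ n.
    by rewrite mulrBr tel opprB -addrA; congr (_ + _); rewrite addrAC subrr sub0r.
  rewrite (le_trans (nrmB _ _)) // -[leRHS](divfK (lt0r_neq0 c0)) [leRHS]mulrC.
  rewrite [leRHS]mulrDl mul1r lerD ?(ltW h2) //.
  by rewrite (le_trans (nrmM _ _)) // ler_wpM2l ?nrm_ge0 // ltW.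
have [n h1 h2] := key _ (divr_gt0 e0 c0).
have -> : y * (1 - x) - 1 = (y - \sum_(0 <= k < n) x ^+ k) * (1 - x) - x ^+ n.
  by rewrite mulrBl comm_tel opprB -addrA; congr (_ + _); rewrite addrAC subrr sub0r.
rewrite (le_trans (nrmB _ _)) // -[leRHS](divfK (lt0r_neq0 c0)).
rewrite [leRHS]mulrDr mulr1 lerD ?(ltW h2) //.
by rewrite (le_trans (nrmM _ _)) // ler_wpM2r ?nrm_ge0 // ltW.
Qed.

End RealNorm.

(** * Vanishing spectral radius and its stability *)

Section Radius.
Variables (R : realType) (A : banachAlgType R[i]).
Implicit Types (w x y z : balg A) (k : R[i]).

Definition radius0 w :=
  forall t : R, 0 < t -> exists C, forall n, nrm (w ^+ n) * t ^+ n <= C.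

(** By submultiplicativity the value at [n] is at most the value at [n - N], so the exponents below
    [N] control all others; the sum of their values is the bound. *)
Lemma radius0_pow_le1 w :
  (forall t : R, 0 < t -> exists2 N, (0 < N)%N & nrm (w ^+ N) * t ^+ N <= 1) ->
  radius0 w.
Proof.
move=> h t t0; have [N N0 hN] := h t t0.
have t0' n : 0 <= t ^+ n by rewrite exprn_ge0 // ltW.
have p n : 0 <= nrm (w ^+ n) * t ^+ n by rewrite mulr_ge0 ?nrm_ge0.
exists (\sum_(l < N) nrm (w ^+ l) * t ^+ l).
elim/ltn_ind => n IH; have [nN|Nn] := ltnP n N.
  by rewrite (bigD1 (Ordinal nN)) //= lerDl sumr_ge0.
apply: le_trans (IH (n - N)%N _); last by rewrite ltn_subrL N0 (leq_trans N0).
rewrite -{1 2}(subnK Nn) !exprD mulrA.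
apply: le_trans (_ : nrm (w ^+ (n - N)) * nrm (w ^+ N) * t ^+ (n - N) * t ^+ N <= _).
  by rewrite !ler_wpM2r ?nrmM.
have -> : nrm (w ^+ (n - N)) * nrm (w ^+ N) * t ^+ (n - N) * t ^+ N =
   (nrm (w ^+ (n - N)) * t ^+ (n - N)) * (nrm (w ^+ N) * t ^+ N) by ring.
by rewrite ler_piMr.
Qed.

Lemma radius0_comm_mul w x : radius0 w -> GRing.comm x w -> radius0 (w * x).
Proof.
move=> hw cxw t t0.
(* Rescaling [t] by [nrm x + 1] absorbs the powers of [x]; the added 1 keeps the parameter
   positive. *)
have b0 : 0 < nrm x + 1 by rewrite ltr_wpDl ?nrm_ge0.
have [C hC] := hw ((nrm x + 1) * t) (mulr_gt0 b0 t0).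
exists (C * nrm (1 : balg A)) => n.
have -> : (w * x) ^+ n = w ^+ n * x ^+ n by apply: exprMn_comm; apply: commr_sym.
have t0' : 0 <= t ^+ n by rewrite exprn_ge0 // ltW.
apply: le_trans (_ : nrm (w ^+ n) * ((nrm x + 1) * t) ^+ n * nrm (1 : balg A) <= _); last first.
  by rewrite ler_wpM2r ?nrm_ge0.
have -> : nrm (w ^+ n) * ((nrm x + 1) * t) ^+ n * nrm (1 : balg A) =
    nrm (w ^+ n) * (nrm (1 : balg A) * (nrm x + 1) ^+ n) * t ^+ n.
  by rewrite exprMn; ring.
rewrite ler_wpM2r //.
rewrite (le_trans (nrmM _ _)) // ler_wpM2l ?nrm_ge0 //.
rewrite (le_trans (nrmX _ _)) // ler_wpM2l ?nrm_ge0 //.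
by rewrite lerXn2r ?nnegrE ?nrm_ge0 ?(ltW b0) // lerDl.
Qed.

(** Boundedness at [2 * t] yields decay like [C / 2 ^+ n] at [t]. *)
Lemma radius0_small w (t e : R) : radius0 w -> 0 < t -> 0 < e ->
  exists n, nrm (w ^+ n) * t ^+ n < e.
Proof.
move=> hw t0 e0; have [C hC] := hw (2 * t) (mulr_gt0 (ltr0Sn R 1) t0).
have [n hn] : exists n, C / e < 2 ^+ n :> R.
  have := archi_boundP (normr_ge0 (C / e)); set m := Num.bound _ => hm.
  exists m; rewrite (le_lt_trans (ler_norm _)) // (lt_trans hm) //.
  by rewrite -natrX ltr_nat ltn_expl.
exists n; have t2 : 0 < 2 ^+ n :> R by rewrite exprn_gt0.
rewrite -(ltr_pM2r t2) (le_lt_trans _ (_ : C < _)) //.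
  by apply: le_trans (hC n); rewrite exprMn -mulrA [t ^+ n * _]mulrC.
by move: hn; rewrite ltr_pdivrMr // mulrC.
Qed.

(** Some [1 - w ^+ n] is invertible by the Neumann series, and [1 - w] is a factor of it on both
    sides. *)
Lemma radius0_invertible w : radius0 w -> invertible (1 - w).
Proof.
move=> hw; have [n] := radius0_small hw ltr01 ltr01.
rewrite expr1n mulr1 => /invertible_1sub [y [h1 h2]].
pose s := \sum_(k < n) w ^+ k.
have tel : (1 - w) * s = 1 - w ^+ n by rewrite -opprB mulNr -subrX1 opprB.
have comm_tel : s * (1 - w) = 1 - w ^+ n.
  rewrite -tel; apply/esym/commr_sum => k _.
  by apply: commrX; apply/commr_sym/commrB; [exact: commr1|exact: commr_refl].
exists (s * y); split; first by rewrite mulrA tel.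
have -> : s * y = y * s.
  rewrite -[LHS]mul1r -h2 -mulrA [_ * (s * y)]mulrA.
  suff -> : (1 - w ^+ n) * s = s * (1 - w ^+ n) by rewrite -[s * _ * y]mulrA h1 mulr1.
  by rewrite -{1}comm_tel -mulrA tel.
by rewrite -mulrA comm_tel.
Qed.

Lemma radius0_qnil w : radius0 w -> qnil w.
Proof.
move=> hw x cx; rewrite -[w * x]opprK -mulrN.
by apply/radius0_invertible/radius0_comm_mul => //; apply/commr_sym/commrN/commr_sym.
Qed.

Lemma radius0_swap x y : radius0 (x * y) -> radius0 (y * x).
Proof.
move=> h t t0; have [C hC] := h t t0.
have sw n : (y * x) ^+ n.+1 = y * (x * y) ^+ n * x.
  elim: n => [|n IH]; first by rewrite expr1 expr0 mulr1.
  by rewrite exprSr IH exprSr !mulrA.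
exists (Num.max (nrm (1 : balg A)) (nrm y * C * nrm x * t)) => -[|n].
  by rewrite !expr0 mulr1 le_max lexx.
rewrite le_max; apply/orP; right; rewrite sw exprSr mulrA ler_wpM2r ?(ltW t0) //.
have tn : 0 <= t ^+ n by rewrite exprn_ge0 // ltW.
apply: le_trans (_ : nrm y * nrm ((x * y) ^+ n) * nrm x * t ^+ n <= _).
  rewrite ler_wpM2r // (le_trans (nrmM _ _)) // ler_wpM2r ?nrm_ge0 //.
  exact: nrmM.
by rewrite mulrAC -[_ * _ * t ^+ n]mulrA ler_wpM2r ?nrm_ge0 // ler_wpM2l ?nrm_ge0.
Qed.

(** When a power is expanded, every [m] followed by another factor dies, which leaves the single
    correction [w ^+ n * m]. *)
Lemma radius0_sub_nil w m :
  radius0 w -> m * w = 0 -> m * m = 0 -> radius0 (w - m).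
Proof.
move=> hw mw mm t t0; have [C hC] := hw t t0.
have pw n : (w - m) ^+ n.+1 = w ^+ n.+1 - w ^+ n * m.
  elim: n => [|n IH]; first by rewrite !expr1 expr0 mul1r.
  rewrite exprSr IH mulrBl !mulrBr -mulrA mw mulr0 sub0r -mulrA mm mulr0.
  by rewrite oppr0 subr0 -!exprSr.
exists (Num.max (nrm (1 : balg A)) (C + C * (nrm m * t))) => -[|n].
  by rewrite !expr0 mulr1 le_max lexx.
rewrite le_max; apply/orP; right.
have tn (k : nat) : 0 <= t ^+ k by rewrite exprn_ge0 // ltW.
rewrite pw; apply: le_trans (_ : (nrm (w ^+ n.+1) + nrm (w ^+ n) * nrm m) * t ^+ n.+1 <= _).
  rewrite ler_wpM2r // (le_trans (nrmB _ _)) // lerD2l; exact: nrmM.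
rewrite mulrDl lerD ?hC // exprSr.
have -> : nrm (w ^+ n) * nrm m * (t ^+ n * t) = nrm (w ^+ n) * t ^+ n * (nrm m * t).
  by ring.
by rewrite ler_wpM2r // mulr_ge0 ?nrm_ge0 ?(ltW t0).
Qed.

End Radius.

(** * The resolvent on discs *)

Section Resolvent.
Variables (R : realType) (A : banachAlgType R[i]).
Implicit Types (w x y z g h : balg A) (k l : R[i]).

Definition is_inv x y := x * y = 1 /\ y * x = 1.

Lemma cabs_leD k : cabs k <= `|complex.Re k| + `|complex.Im k|.
Proof.
case: k => a b; rewrite -(cabs_realE a) -(cabs_realE b) -lecR rmorphD /=.
rewrite -!cabsE; have -> : (a +i* b)%C = a%:C%C + 'i%C * b%:C%C by simpc.
rewrite (le_trans (ler_normD _ _)) // lerD2l normrM [`|'i%C|]normc_def /=.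
by rewrite expr0n /= expr1n add0r sqrtr1 mul1r.
Qed.

Lemma normr_Re_le k : `|complex.Re k| <= cabs k.
Proof. by rewrite -lecR -cabsE normc_ge_Re. Qed.

Lemma normr_Im_le k : `|complex.Im k| <= cabs k.
Proof.
by case: k => a b; rewrite /cabs normc_def /= -sqrtr_sqr ler_wsqrtr // lerDr sqr_ge0.
Qed.

Lemma resolventB w k l g h :
  is_inv (1 - k *: w) g -> is_inv (1 - l *: w) h ->
  g - h = (k - l) *: (g * w * h).
Proof.
move=> [_ hg] [hh _].
have -> : g - h = g * (1 - l *: w - (1 - k *: w)) * h.
  by rewrite mulrBr mulrBl -mulrA hh hg mulr1 mul1r.
have -> : 1 - l *: w - (1 - k *: w) = (k - l) *: w.
  by rewrite opprB addrC addrA subrK -scalerBl.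
by rewrite -scalerAr -scalerAl.
Qed.

(** Near a given point the resolvent identity bounds inverses by twice the norm of the inverse at
    that point; compactness of a square containing the disc makes the bound uniform. *)
Lemma resolvent_bounded w (r : R) :
  (forall k, invertible (1 - k *: w)) ->
  exists M : R, forall k g, cabs k <= r -> is_inv (1 - k *: w) g -> nrm g <= M.
Proof.
move=> hw.
pose P (M : R) (p : R * R) :=
  forall g, is_inv (1 - (p.1 +i* p.2)%C *: w) g -> nrm g <= M.
have cpt : compact (`[- r, r] `*` `[- r, r] : set (R * R)).
  by apply: compact_setX; exact: segment_compact.
have near_P : \forall M \near +oo, forall p, (`[- r, r] `*` `[- r, r]) p -> P M p.
  move/compact_near_coveringP : cpt; apply => -[a b] _.
  have [g0 [h1 h2]] := hw (a +i* b)%C.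
  (* This radius gives [2 * d * nrm w * nrm g0 <= 1 / 2], so that half of [nrm g] is absorbed in the
     triangle inequality. *)
  pose d := 1 / (4 * (nrm w * nrm g0 + 1)).
  have c0 : 0 < nrm w * nrm g0 + 1 by rewrite ltr_wpDl // mulr_ge0 ?nrm_ge0.
  have d0 : 0 < d by rewrite divr_gt0 // mulr_gt0.
  exists ([set p | `|a - p.1| < d /\ `|b - p.2| < d], [set M | 2 * nrm g0 <= M]) => /=.
    split; last by exists (2 * nrm g0); split; [exact: num_real|move=> M /ltW].
    exists ([set x | `|a - x| < d], [set x | `|b - x| < d]) => /=.
      split; apply/nbhs_ballP; exists d => //.
    by move=> [x y] /=.
  move=> [[x y] M] /= [[xa yb] hM] g hg; apply: le_trans hM.
  have eq : g - g0 = ((x +i* y)%C - (a +i* b)%C) *: (g * w * g0).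
    by apply: resolventB.
  have ck : cabs ((x +i* y)%C - (a +i* b)%C) <= d + d.
    rewrite (le_trans (cabs_leD _)) //= lerD // ltW // distrC //.
  have : nrm (g - g0) <= (d + d) * (nrm g * nrm w * nrm g0).
    rewrite eq nrmZ.
    rewrite ler_pM ?nrm_ge0 //; first by rewrite -lecR -cabsE normr_ge0.
    by rewrite (le_trans (nrmM _ _)) // ler_wpM2r ?nrm_ge0 // nrmM.
  have : (d + d) * (nrm g * nrm w * nrm g0) <= nrm g / 2.
    have -> : (d + d) * (nrm g * nrm w * nrm g0) =
        (nrm g / 2) * ((nrm w * nrm g0) / (nrm w * nrm g0 + 1)).
      by rewrite /d; field; rewrite gt_eqF.
    rewrite ler_piMr ?divr_ge0 ?nrm_ge0 // ler_pdivrMr // mul1r lerDl //.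
  have : nrm g <= nrm (g - g0) + nrm g0 by rewrite -{1}(subrK g0 g) nrmD.
  by lra.
have [M [_ hM]] := near_P.
exists (M + 1) => -[a b] g kr hg.
apply: (hM (M + 1) _ (a, b)) => //; first by rewrite ltrDl.
have := le_trans (normr_Re_le _) kr; have := le_trans (normr_Im_le _) kr.
by rewrite !ler_norml /= => hb ha; split; rewrite /= in_itv.
Qed.

End Resolvent.

(** * Rickart's argument: quasinilpotency as vanishing spectral radius *)

Section SpectralRadius.
Variables (R : realType) (A : banachAlgType R[i]).
Implicit Types (w x y z g h : balg A) (k l : R[i]) (r s e : R).

(** Partial fractions: over the common denominator, the numerators [1 + k *: w] and [1 - k *: w] add
    up to 2. *)
Lemma is_inv_average w k g h :
  is_inv (1 - k *: w) g -> is_inv (1 - (- k) *: w) h ->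
  is_inv (1 - k ^+ 2 *: w ^+ 2) (2^-1 *: (g + h)).
Proof.
rewrite scaleNr opprK => -[g1 g2] [h1 h2].
have fac1 : 1 - k ^+ 2 *: w ^+ 2 = (1 + k *: w) * (1 - k *: w).
  rewrite mulrBr mulr1 mulrDl mul1r -scalerAl -scalerAr scalerA -!expr2.
  by rewrite opprD addrA addrK.
have fac2 : 1 - k ^+ 2 *: w ^+ 2 = (1 - k *: w) * (1 + k *: w).
  rewrite mulrDr mulr1 mulrBl mul1r -scalerAl -scalerAr scalerA -!expr2.
  by rewrite addrA subrK.
have two : 2^-1 *: (1 + k *: w + (1 - k *: w)) = 1 :> balg A.
  have -> : 1 + k *: w + (1 - k *: w) = (2 : R[i]) *: (1 : balg A).
    by rewrite addrACA subrr addr0 scaler_nat.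
  by rewrite scalerA mulVf ?scale1r ?pnatr_eq0.
split.
  by rewrite -scalerAr mulrDr {1}fac1 fac2 -!mulrA g1 h1 !mulr1.
by rewrite -scalerAl mulrDl {1}fac2 fac1 !mulrA g2 h2 !mul1r.
Qed.

Lemma cabsN k : cabs (- k) = cabs k.
Proof. by rewrite /cabs normrN. Qed.

Lemma cabsX k n : cabs (k ^+ n) = cabs k ^+ n.
Proof. by apply/complexI; rewrite rmorphXn /= -!cabsE normrX. Qed.

(* The roots [sqrtc k] and [- sqrtc k] stay in the smaller disc, which is what
   makes the bound [e] uniform in [m]. *)
Lemma resolvent_gap w r s e : 0 <= r ->
  (forall k, cabs k <= r -> exists g h, [/\ is_inv (1 - k *: w) g,
     is_inv (1 - (s%:C%C * k) *: w) h & nrm (g - h) <= e]) ->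
  forall m k, cabs k <= r ^+ (2 ^ m) -> exists g h,
    [/\ is_inv (1 - k *: w ^+ (2 ^ m)) g,
     is_inv (1 - ((s ^+ (2 ^ m))%:C%C * k) *: w ^+ (2 ^ m)) h & nrm (g - h) <= e].
Proof.
move=> r0 h0; elim=> [k|m IH k kr]; first by rewrite expn0 !expr1; exact: h0.
pose l := sqrtc k; have lk : l ^+ 2 = k by exact: sqr_sqrtc.
have lr : cabs l <= r ^+ (2 ^ m).
  rewrite -(@ler_pXn2r _ 2) ?nnegrE ?exprn_ge0 //; last by rewrite -lecR -cabsE normr_ge0.
  by rewrite -cabsX lk -exprM -expnSr.
have [g1 [h1 [a1 b1 c1]]] := IH l lr.
have [|g2 [h2 [a2 b2 c2]]] := IH (- l); first by rewrite cabsN.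
exists (2^-1 *: (g1 + g2)), (2^-1 *: (h1 + h2)).
rewrite mulrN in b2.
rewrite expnSr !exprM -lk; split; first exact: is_inv_average.
  by rewrite rmorphXn -exprMn; exact: is_inv_average.
rewrite -scalerBr opprD addrACA nrmZ.
have -> : cabs (2^-1 : R[i]) = 2^-1.
  have -> : 2^-1 = (2^-1 : R)%:C%C by rewrite fmorphV rmorph_nat.
  by rewrite cabs_real // invr_ge0.
have := nrmD (g1 - h1) (g2 - h2); lra.
Qed.

(** A small [y] puts [h] close to 1, hence [g] as well, and then [x] is small. *)
Lemma ladder_step x y g h :
  is_inv (1 - x) g -> is_inv (1 - y) h -> nrm (g - h) <= 8^-1 ->
  nrm y <= 8^-1 -> nrm x <= 2^-1.
Proof.
move=> [_ gx] [yh _] gh y8.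
have eh : h - 1 = y + y * (h - 1).
  rewrite mulrBr mulr1 [RHS]addrC subrK.
  by rewrite -yh mulrBl mul1r opprB addrC subrK.
have ex : x = (g - 1) - (g - 1) * x.
  by rewrite -{1}[g - 1]mulr1 -mulrBr mulrBl gx mul1r opprB addrC subrK.
have g1 : nrm (g - 1) <= nrm (g - h) + nrm (h - 1).
  have -> : g - 1 = g - h + (h - 1) by rewrite addrA subrK.
  exact: nrmD.
have h1 : nrm (h - 1) <= nrm y + 8^-1 * nrm (h - 1).
  rewrite {1}eh (le_trans (nrmD _ _)) // lerD2l (le_trans (nrmM _ _)) //.
  by rewrite ler_wpM2r // nrm_ge0.
(* Absorbing the last term of [h1] bounds [h - 1] by [1 / 7], and [1 / 7 + 1 / 8 = 15 / 56]. The
   same absorption then bounds [x] by [15 / 41]. *)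
have g2 : nrm (g - 1) <= 15 / 56 by lra.
have : nrm x <= nrm (g - 1) + 15 / 56 * nrm x.
  rewrite {1}ex (le_trans (nrmB _ _)) // lerD2l (le_trans (nrmM _ _)) //.
  by rewrite ler_wpM2r // nrm_ge0.
lra.
Qed.

Lemma nrm_sqr_le w n r e : 0 <= r -> nrm (w ^+ n) * r ^+ n <= e ->
  nrm (w ^+ (n * 2)) * r ^+ (n * 2) <= e ^+ 2.
Proof.
move=> r0 h; rewrite !exprM.
have p : 0 <= nrm (w ^+ n) * r ^+ n by rewrite mulr_ge0 ?nrm_ge0 ?exprn_ge0.
apply: le_trans (_ : (nrm (w ^+ n) * r ^+ n) ^+ 2 <= _).
  by rewrite exprMn ler_wpM2r ?exprn_ge0 // !expr2 nrmM.
by rewrite lerXn2r // nnegrE // (le_trans p).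
Qed.

Lemma resolvent_radius0 w : (forall k, invertible (1 - k *: w)) -> radius0 w.
Proof.
move=> hw; apply: radius0_pow_le1 => r r0.
have [M hM] := resolvent_bounded r hw.
(* By the resolvent identity, passing from [k] to [s * k] with [1 - s = (8 * c)^-1] changes the
   resolvent by at most [8^-1]; the added 1 keeps [s] positive. *)
pose c := r * nrm w * M ^+ 2 + 1.
have c1 : 1 <= c by rewrite lerDr mulr_ge0 ?sqr_ge0 // mulr_ge0 ?nrm_ge0 // ltW.
have c0 : 0 < c by lra.
pose s := 1 - (8 * c)^-1.
have s1 : s < 1 by rewrite ltrBlDr ltrDl invr_gt0 mulr_gt0.
have s0 : 0 < s.
  rewrite subr_gt0 invf_lt1 ?mulr_gt0 //; lra.
have gap0 k : cabs k <= r -> exists g h, [/\ is_inv (1 - k *: w) g,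
     is_inv (1 - (s%:C%C * k) *: w) h & nrm (g - h) <= 8^-1].
  move=> kr; have [g ig] := hw k; have [h ih] := hw (s%:C%C * k).
  exists g, h; split => //.
  have k0 : 0 <= cabs k by rewrite -lecR -cabsE normr_ge0.
  have gM : nrm g <= M by exact: hM ig.
  have hM' : nrm h <= M.
    apply: hM ih; rewrite cabsM cabs_real ?(ltW s0) //.
    by rewrite (le_trans _ kr) // ler_piMl // ltW.
  rewrite (resolventB ig ih) nrmZ.
  have -> : k - s%:C%C * k = (8 * c)^-1%:C%C * k.
    by rewrite /s rmorphB rmorph1 mulrBl mul1r opprB addrC subrK.
  rewrite cabsM cabs_real ?invr_ge0 ?mulr_ge0 ?(ltW c0) //.
  have gwh : nrm (g * w * h) <= M * nrm w * M.
    rewrite (le_trans (nrmM _ _)) // ler_pM ?nrm_ge0 //.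
    by rewrite (le_trans (nrmM _ _)) // ler_pM ?nrm_ge0.
  apply: le_trans (_ : (8 * c)^-1 * r * (M * nrm w * M) <= _).
    rewrite ler_pM ?nrm_ge0 ?mulr_ge0 ?invr_ge0 ?mulr_ge0 ?(ltW c0) //.
    by rewrite ler_wpM2l // invr_ge0 mulr_ge0 // ltW.
  have -> : (8 * c)^-1 * r * (M * nrm w * M) = 8^-1 * ((c - 1) / c).
    by rewrite {2}/c addrK; field; rewrite gt_eqF.
  rewrite ler_piMr ?invr_ge0 // ler_pdivrMr // mul1r; lra.
have gap := resolvent_gap (ltW r0) gap0.
(* One rung replaces [r * s ^+ j.+1] by [r * s ^+ j]. It weakens [8^-1] to [2^-1]; squaring twice
   restores it with [1 / 16], whence [m.+2]. *)
have down j : (exists m, nrm (w ^+ (2 ^ m)) * (r * s ^+ j) ^+ (2 ^ m) <= 8^-1) ->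
    exists m, nrm (w ^+ (2 ^ m)) * r ^+ (2 ^ m) <= 8^-1.
  elim: j => [|j IH] [m hm]; first by exists m; rewrite expr0 mulr1 in hm.
  apply: IH; have sj : 0 <= s ^+ j by rewrite exprn_ge0 // ltW.
  have t0 : 0 <= r * s ^+ j by rewrite mulr_ge0 // ltW.
  exists m.+2; pose t := (r * s ^+ j) ^+ (2 ^ m).
  have tt : 0 <= t by rewrite exprn_ge0.
  have [|g [h [a b cc]]] := gap m t%:C%C.
    rewrite cabs_real // lerXn2r ?nnegrE ?(ltW r0) //.
    by rewrite ler_piMr ?(ltW r0) // exprn_ile1 // ltW.
  have : nrm (t%:C%C *: w ^+ (2 ^ m)) <= 2^-1.
    apply: ladder_step a b cc _.
    rewrite nrmZ -rmorphM cabs_real ?mulr_ge0 // ?exprn_ge0 ?(ltW s0) //.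
    by rewrite mulrC -exprMn mulrCA -exprS.
  rewrite nrmZ cabs_real // mulrC => /(nrm_sqr_le t0)/(nrm_sqr_le t0).
  rewrite -!expnSr => /le_trans; apply; lra.
(* As [s < 1], a rung low enough to start from with [m = 0] exists. *)
have [j hj] : exists j, nrm w * (r * s ^+ j) <= 8^-1.
  have /cvgrPdist_lt /(_ 8^-1) : geometric (nrm w * r) s @ \oo --> (0 : R).
    by apply: cvg_geometric; rewrite gtr0_norm.
  rewrite invr_gt0 ltr0n => /(_ isT) [n _ /(_ n (leqnn n))] /=.
  rewrite sub0r normrN -mulrA => /(le_lt_trans (ler_norm _)) /ltW.
  by exists n.
have [|m hm] := down j; first by exists 0%N; rewrite expn0 !expr1.
exists (2 ^ m)%N; first by rewrite expn_gt0.
lra.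
Qed.

Lemma qnilP w : qnil w <-> radius0 w.
Proof.
split=> [qw|]; last exact: radius0_qnil.
(* Only the scalar elements of the commutant are tested. *)
apply: resolvent_radius0 => k; have := qw (- k%:A).
rewrite mulrN -scalerAr mulr1; apply.
apply/commr_sym/commrN; rewrite /GRing.comm -scalerAl -scalerAr.
by rewrite mul1r mulr1.
Qed.

End SpectralRadius.

(** * Spectral idempotents and generalized Hirano inverses *)

Section Hirano.
Variables (R : realType) (A : banachAlgType R[i]).
Implicit Types (a b c d p q h t u v x y z f : balg A).

(** The norms [nrm (u ^+ n)] decay faster than any geometric sequence, so they beat [V ^+ n]. *)
Lemma radius0_vanish u t (K V : R) : 0 <= K -> 0 <= V -> radius0 u ->
  (forall n, nrm t <= K * nrm (u ^+ n) * V ^+ n) -> t = 0.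
Proof.
move=> K0 V0 hu h; apply: nrm_small => e e0.
have K1 : 0 < K + 1 by lra.
have V1 : 0 < V + 1 by lra.
have [n hn] := radius0_small hu V1 (divr_gt0 e0 K1).
apply: le_trans (h n) _; rewrite -(divfK (lt0r_neq0 K1) e) [leRHS]mulrC -mulrA.
rewrite ler_pM ?mulr_ge0 ?nrm_ge0 ?exprn_ge0 ?lerDl //.
apply: le_trans (ltW hn); rewrite ler_wpM2l ?nrm_ge0 // lerXn2r ?nnegrE ?lerDl //.
exact: ltW.
Qed.

(** Iterating the equation gives [t = u ^+ n * t * v ^+ n]. *)
Lemma radius0_fix_left u v t : radius0 u -> t = u * t * v -> t = 0.
Proof.
move=> hu tuv; apply: (@radius0_vanish u t (nrm t * nrm (1 : balg A)) (nrm v)) => //.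
- by rewrite mulr_ge0 ?nrm_ge0.
- exact: nrm_ge0.
move=> n; have -> : nrm t * nrm (1 : balg A) * nrm (u ^+ n) * nrm v ^+ n =
  nrm (u ^+ n) * nrm t * (nrm (1 : balg A) * nrm v ^+ n) by ring.
have {1}-> : t = u ^+ n * t * v ^+ n.
  elim: n => [|n IH]; first by rewrite !expr0 mul1r mulr1.
  by rewrite exprSr exprS {1}IH {1}tuv !mulrA.
rewrite (le_trans (nrmM _ _)) // ler_pM ?nrm_ge0 ?nrmM //.
exact: nrmX.
Qed.

Lemma radius0_fix_right u v t : radius0 u -> t = v * t * u -> t = 0.
Proof.
move=> hu tuv; apply: (@radius0_vanish u t (nrm t * nrm (1 : balg A)) (nrm v)) => //.
- by rewrite mulr_ge0 ?nrm_ge0.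
- exact: nrm_ge0.
move=> n; have -> : nrm t * nrm (1 : balg A) * nrm (u ^+ n) * nrm v ^+ n =
  nrm (1 : balg A) * nrm v ^+ n * nrm t * nrm (u ^+ n) by ring.
have {1}-> : t = v ^+ n * t * u ^+ n.
  elim: n => [|n IH]; first by rewrite !expr0 mul1r mulr1.
  by rewrite exprSr exprS {1}IH {1}tuv !mulrA.
rewrite (le_trans (nrmM _ _)) // ler_wpM2r ?nrm_ge0 // (le_trans (nrmM _ _)) //.
by rewrite ler_wpM2r ?nrm_ge0 // nrmX.
Qed.

(** Here [f] is idempotent, [y] inverts [x] in the corner of [f], and [(1 - f) * x] is
    quasinilpotent. Both off-diagonal corners of [z] solve a fixed-point equation that forces them
    to vanish, so [z] commutes with [f] and then with [y]. *)
Lemma comm_spectral_inverse x y f z :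
  x * y = f -> y * x = f -> f * y = y -> radius0 (x - f) ->
  GRing.comm z x -> GRing.comm z y.
Proof.
move=> xy yx yE hw zx.
have ff : f * f = f by rewrite -{2}yx mulrA yE yx.
have fx : f * x = x * f by rewrite -{1}xy -yx mulrA.
have fy : f * y = y * f by rewrite -{1}yx -xy mulrA.
have g0 : (1 - f) * (1 - f) = 1 - f.
  by rewrite mulrBl mul1r mulrBr mulr1 ff subrr subr0.
have gx : (1 - f) * x = x * (1 - f) by rewrite mulrBl mul1r mulrBr mulr1 fx.
have small : radius0 ((1 - f) * x).
  have -> : (1 - f) * x = (x - f) * (1 - f).
    by rewrite gx [LHS]mulrBr [RHS]mulrBr !mulr1 mulrBl ff opprB addrA subrK.
  apply: radius0_comm_mul => //; apply: commrB => //.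
  by apply/commr_sym/commrB; [exact: commr1|exact: commr_refl].
have t1 : (1 - f) * z * f = 0.
  apply: (radius0_fix_left (v := y) small).
  rewrite !mulrA gx -[x * _ * _]mulrA g0 -gx -[(1 - f) * x * z]mulrA -zx.
  by rewrite -[_ * f * y]mulrA fy !mulrA -[_ * x * y]mulrA xy -[_ * f * f]mulrA ff.
have t2 : f * z * (1 - f) = 0.
  apply: (radius0_fix_right (v := y) small).
  rewrite !mulrA -[_ * (1 - f) * (1 - f)]mulrA g0 -[_ * (1 - f) * x]mulrA gx.
  by rewrite !mulrA -[_ * z * x]mulrA zx !mulrA -fy -[f * y * x]mulrA yx ff.
move: t1 t2; rewrite mulrBl mul1r mulrBl mulrBr mulr1 => /eqP; rewrite subr_eq0 => /eqP zf.
move=> /eqP; rewrite subr_eq0 => /eqP fz.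
have zf' : z * f = f * z by exact: etrans zf (esym fz).
have yf : y * f = y by rewrite -fy.
(* The chain is [z y = z f y = f z y = y x z y = y z x y = y z f = y f z = y z]. *)
rewrite /GRing.comm -{1}yE mulrA zf' -{1}yx -!mulrA [x * _]mulrA -zx.
by rewrite -[z * x * y]mulrA xy zf' mulrA yf.
Qed.

Lemma Hirano_transfer p q :
  (p ^+ 2 - q ^+ 2) * p = 0 -> (p ^+ 2 - q ^+ 2) * q = 0 ->
  has_generalized_Hirano_inverse p -> has_generalized_Hirano_inverse q.
Proof.
set n := p ^+ 2 - q ^+ 2 => np nq [h [/= hp hph /qnilP hw]].
have php : h * p = p * h by exact: hp.
have phh : p * h * h = h by rewrite -php -hph.
have hph' : h * (p * h) = h by rewrite mulrA -hph.
have nh : n * h = 0 by rewrite -phh !mulrA np !mul0r.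
have nn : n * n = 0 by rewrite {2}/n mulrBr !expr2 !mulrA np nq !mul0r subrr.
have qqE : q * q = p * p - n by rewrite /n !expr2 opprB addrC subrK.
clearbody n.
have qqh : q * q * h = p * p * h by rewrite qqE mulrBl nh subr0.
have ppqq : p * p * (q * q) = q * q * (q * q).
  by rewrite {2}qqE mulrBl [n * _]mulrA nq mul0r subr0.
have hhpp : h * h * (p * p) = p * h.
  by rewrite mulrA -[h * h * p]mulrA php hph' php.
have qqhh : q * q * (h * h) = p * h.
  by rewrite mulrA qqh -!mulrA [p * (h * h)]mulrA phh.
(* [y] is built to invert [q * q] relative to [f]. *)
pose f := h * h * (q * q); pose y := h * h * f.
have xy : q * q * y = f by rewrite /y mulrA qqhh /f !mulrA phh.
have yx : y * (q * q) = f.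
  rewrite /y -mulrA /f -[_ * (q * q) * (q * q)]mulrA -ppqq [h * h * (p * p * _)]mulrA.
  by rewrite hhpp mulrA -[h * h * (p * h)]mulrA hph'.
have fy : f * y = y.
  rewrite /y {1}/f -mulrA [q * q * (_ * _)]mulrA qqhh.
  by congr (_ * _); rewrite /f !mulrA phh.
have small : radius0 (q * q - f).
  have -> : q * q - f = p ^+ 2 - p * h - (1 - h * h) * n.
    rewrite /f qqE mulrBr hhpp mulrBl mul1r expr2.
rewrite !opprB -!addrA; congr (_ + _); rewrite addrCA [RHS]addrCA; congr (_ + _).
    exact: addrC.
  (* As [n p = n h = n n = 0], the correction [(1 - h * h) * n] kills [p ^+ 2 - p * h] from the left
     and squares to zero. *)
  apply: radius0_sub_nil => //.
    by rewrite -mulrA mulrBr expr2 !mulrA np !mul0r subrr mulr0.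
  by rewrite -mulrA [n * _]mulrA [n * (1 - _)]mulrBr mulr1 [n * (h * h)]mulrA nh mul0r subr0 nn mulr0.
clearbody y f.
(* [q] commutes with [q * q], hence with [y], although it need not commute with [h]. *)
have qy : q * y = y * q.
  apply: (comm_spectral_inverse xy yx fy small).
  by rewrite /GRing.comm mulrA.
have yf : y * f = y by rewrite -{1}xy mulrA yx fy.
(* Since [q * (y * q) = f], the residue of this witness is [q * q - f]. *)
exists (y * q); split=> /=.
- by rewrite /commutant /GRing.comm /= mulrA -qy.
- by rewrite !mulrA -[y * q * q]mulrA -[y * (q * q) * y]mulrA xy yf.
- by apply/qnilP; rewrite mulrA qy -mulrA yx expr2.
Qed.

Lemma Hirano_Cline b d :
  has_generalized_Hirano_inverse (d * b) ->
  has_generalized_Hirano_inverse (b * d).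
Proof.
move=> [h [/= hc hh /qnilP hw]]; set s := d * b in hc hh hw.
have sh : h * s = s * h by exact: hc.
have shh : s * h * h = h by rewrite -sh -hh.
have hhs : h * h * s = h by rewrite -mulrA sh mulrA -hh.
have gl : b * (h * h) * d * (b * d) = b * h * d.
  by rewrite -[in RHS]hhs -!mulrA [d * (b * d)]mulrA.
have gr : b * d * (b * (h * h) * d) = b * h * d.
  by rewrite -[in RHS]shh -!mulrA [d * (b * _)]mulrA.
exists (b * (h * h) * d); split=> /=.
- by rewrite /commutant /GRing.comm /= gl gr.
- by rewrite gl {1}hh -!mulrA [d * (b * _)]mulrA.
rewrite gr; have -> : (b * d) ^+ 2 - b * h * d = b * ((s - h) * d).
  by rewrite mulrBl mulrBr expr2 !mulrA.
(* Swapping [b] with [(s - h) * d] turns the residue into [(s - h) * s = s ^+ 2 - s * h]. *)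
apply/qnilP/radius0_swap; rewrite -mulrA -/s mulrBl -expr2.
by rewrite sh.
Qed.

End Hirano.
Theorem theorem3p3 (R : realType) (A : banachAlgType R[i]) (a b c d : balg A)
  (Ha : (a * c) ^+ 2 * a = (d * b) ^+ 2 * a)
  (Hd : (a * c) ^+ 2 * d = (d * b) ^+ 2 * d) :
  has_generalized_Hirano_inverse (a * c) <->
  has_generalized_Hirano_inverse (b * d).
Proof.
have np : ((a * c) ^+ 2 - (d * b) ^+ 2) * (a * c) = 0.
  by rewrite mulrA mulrBl Ha subrr mul0r.
have nq : ((a * c) ^+ 2 - (d * b) ^+ 2) * (d * b) = 0.
  by rewrite mulrA mulrBl Hd subrr mul0r.
(* The converse uses Cline's formula with [b] and [d] exchanged, then the transfer from [d * b] to
   [a * c], whose hypotheses are the same up to sign. *)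
split=> [/(Hirano_transfer np nq)/Hirano_Cline //|/Hirano_Cline].
by apply: Hirano_transfer; rewrite -opprB mulNr ?np ?nq oppr0.
Qed.
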